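(* Consider the iterates generated by the inexact PANOC$^+$ algorithm described in the context. The following hold: (i) $(\Phi_k)_{k\in\mathbb{N}}$ converges to a finite value $\varphi_\star\ge\inf\varphi$ from above. (ii) $\sum_{k\in\mathbb{N}}\frac1{\gamma_k}\|\bar x^k-x^k\|^2<\infty$. (iii) $\lim_{k\to\infty}\|x^k-\bar x^k\|=\lim_{k\to\infty}\|x^k-x^{k-1}\|=\lim_{k\to\infty}\|\bar x^k-\bar x^{k-1}\|=0$, and in particular the set of limit points of $(x^k)_{k\in\mathbb{N}}$ is closed and connected, and coincides with that of $(\bar x^k)_{k\in\mathbb{N}}$. (iv) $\sum_{k\in\mathbb{N}}\gamma_k=\infty$. (v) $\liminf_{k\to\infty}\frac1{\gamma_k}\|x^k-\bar x^k\|=0$. (vi) Consider the following assertions: (1) $\varphi$ is level bounded (all its sublevel sets $\{x:\varphi(x)\le c\}$, $c\in\mathbb{R}$, are bounded); (2) $(\bar x^k)_{k\in\mathbb{N}}$ is bounded; (3) $(x^k)_{k\in\mathbb{N}}$ is bounded; (4) $(\gamma_k)_{k\in\mathbb{N}}$ is asymptotically constant, i.e. there exists $\kappa\in\mathbb{N}$ such that $\gamma_k=\gamma_\kappa$ for every $k\ge\kappa$; (5) $f$ has globally Lipschitz-continuous gradient. One has (1) $\Rightarrow$ (2) $\Leftrightarrow$ (3) $\Rightarrow$ (4) $\Leftarrow$ (5).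
   Context: Standing assumptions: $f:\mathbb{R}^n\to\mathbb{R}$ is differentiable with locally Lipschitz-continuous gradient; $g:\mathbb{R}^n\to\mathbb{R}\cup\{\infty\}$ is proper, lower semicontinuous and $\gamma_g$-prox-bounded, meaning that $\gamma_g\in(0,\infty]$ is the supremum of all $\gamma>0$ for which $g+\tfrac1{2\gamma}\|\cdot\|^2$ is bounded below on $\mathbb{R}^n$; $\varphi:=f+g$ satisfies $\inf\varphi>-\infty$. For $b>0$ define $\mathcal L_b(x,z,y):=f(x)+g(z)+\langle y,x-z\rangle+\tfrac b2\|x-z\|^2$. Inexact PANOC$^+$. Inputs: $x^0\in\mathbb{R}^n$, $\gamma_0\in(0,\gamma_g)$, $D\ge0$, $\alpha,\beta\in(0,1)$. Iteration $k=0$ starts at Step 4. For $k=0,1,2,\dots$: Step 1. Set $\gamma_k\leftarrow\gamma_{k-1}$. Step 2. Select an update direction $d^k\in\mathbb{R}^n$ with $\|d^k\|\le D\|\bar x^{k-1}-x^{k-1}\|$ and set $\tau_k=1$. Step 3. Set $x^k=(1-\tau_k)\bar x^{k-1}+\tau_k(x^{k-1}+d^k)$. Step 4. Let $\bar x^k$ be a suboptimal minimizer of $\mathcal L_{1/\gamma_k}(x^k,\cdot,-\nabla f(x^k))$ such that $$\Phi_k:=\mathcal L_{1/\gamma_k}\big(x^k,\bar x^k,-\nabla f(x^k)\big)\le\mathcal L_{1/\gamma_k}\big(x^k,\bar x^{k-1},-\nabla f(x^k)\big).$$ (No (sub)optimality other than this inequality is required. For $k=0$, the symbol $\bar x^{-1}$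 stands for an initial point of $\mathbb{R}^n$ which the algorithm does not specify further. Any exact minimizer of $\mathcal L_{1/\gamma_k}(x^k,\cdot,-\nabla f(x^k))$, i.e. any $\bar x^k\in\mathrm{prox}_{\gamma_k g}(x^k-\gamma_k\nabla f(x^k))$, where $\mathrm{prox}_{\gamma g}(u)=\arg\min_z\{g(z)+\tfrac1{2\gamma}\|z-u\|^2\}$, is admissible.) Step 5. If $f(\bar x^k)>f(x^k)+\langle\nabla f(x^k),\bar x^k-x^k\rangle+\tfrac{\alpha}{2\gamma_k}\|\bar x^k-x^k\|^2$, then set $\gamma_k\leftarrow\gamma_k/2$ and go back to Step 2 if $k>0$, or to Step 4 if $k=0$. Step 6. If $k>0$ and $\Phi_k>\Phi_{k-1}-\beta\tfrac{1-\alpha}{2\gamma_{k-1}}\|\bar x^{k-1}-x^{k-1}\|^2$, then set $\tau_k\leftarrow\tau_k/2$ and go back to Step 3. Step 7. Set $k\leftarrow k+1$ and start the next iteration at Step 1. Within iteration $k$ the variables indexed by $k$ may be overwritten several times; after the iteration is completed, $x^k,\bar x^k,\gamma_k,\tau_k,d^k,\Phi_k$ denote the final accepted values. It is assumed that $x^k\ne\bar x^k$ always holds.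
   Formalization: Two corrections: g(x̄^0) is assumed finite (otherwise Φ_k = ∞ for all k is possible and (i) fails), and connectedness of the set of limit points in (iii) is claimed only for bounded (x^k), since it can fail for unbounded sequences when n ≥ 2. *)

(* Defs.v *)
From HB Require Import structures.
From mathcomp Require Import all_boot all_order all_algebra.
From mathcomp Require Import all_classical all_reals all_analysis.

Set Implicit Arguments.
Unset Strict Implicit.
Unset Printing Implicit Defensive.

Import Order.TTheory GRing.Theory Num.Theory.
Import numFieldNormedType.Exports.

Local Open Scope classical_set_scope.
Local Open Scope ring_scope.

(* The library norm `|u| on 'rV[R]_n is the sup norm, whence the separate
   Euclidean norm [enorm].  Purely qualitative notions (neighborhoods,
   differentiability, boundedness, existence of a Lipschitz constant, cluster
   points) do not depend on the norm and are taken from the library. *)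

Section problem.
Context {R : realType} {n : nat}.
Implicit Types (f : 'rV[R]_n -> R) (g : 'rV[R]_n -> \bar R).
Implicit Types (F : 'rV[R]_n -> 'rV[R]_n) (u v x y z : 'rV[R]_n).

Definition dotv u v : R := \sum_(i < n) u 0 i * v 0 i.

Definition enorm u : R := Num.sqrt (dotv u u).

Definition gradient f x : 'rV[R]_n := \row_i 'D_(delta_mx 0 i) f x.

Definition locally_lipschitz F : Prop :=
  forall x, exists2 U, nbhs x U & [lipschitz F z | z in U].

Definition proper_fun g : Prop :=
  (forall z, g z != -oo%E) /\ exists z, (g z < +oo)%E.

Definition prox_parameters g : set R :=
  [set gamma | 0 < gamma /\ exists m : R, forall z,
    (m%:E <= g z + ((2 * gamma)^-1 * enorm z ^+ 2)%:E)%E].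

Definition prox_bounded g (gamma_g : \bar R) : Prop :=
  (0 < gamma_g)%E /\ gamma_g = ereal_sup (EFin @` prox_parameters g).

Definition cost f g z : \bar R := ((f z)%:E + g z)%E.

Definition level_bounded (phi : 'rV[R]_n -> \bar R) : Prop :=
  forall c : R, bounded_set [set z | (phi z <= c%:E)%E].

Definition lagrangian f g (b : R) x z y : \bar R :=
  ((f x)%:E + g z + (dotv y (x - z))%:E + (b / 2 * enorm (x - z) ^+ 2)%:E)%E.

End problem.

Section inexact_panocp.
Context {R : realType} {n : nat}.
Variables (f : 'rV[R]_n -> R) (g : 'rV[R]_n -> \bar R).
Variables (D alpha beta : R).
Implicit Types (x xbar xp xbarp d : 'rV[R]_n) (gamma gammap tau : R).

Definition model gamma x z : \bar R :=
  lagrangian f g gamma^-1 x z (- gradient f x).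

(* (model gamma x xbar) is the value Phi attached to the pair (x, xbar). *)
Definition suboptimal_min gamma x xbarp xbar : bool :=
  (model gamma x xbar <= model gamma x xbarp)%E.

Definition stepsize_rejected gamma x xbar : bool :=
  f x + dotv (gradient f x) (xbar - x)
      + alpha / (2 * gamma) * enorm (xbar - x) ^+ 2 < f xbar.

Definition linesearch_rejected gammap xp xbarp gamma x xbar : bool :=
  (model gammap xp xbarp
     - (beta * ((1 - alpha) / (2 * gammap)) * enorm (xbarp - xp) ^+ 2)%:E
   < model gamma x xbar)%E.

Definition trial_point xp xbarp d tau : 'rV[R]_n :=
  (1 - tau) *: xbarp + tau *: (xp + d).

(* During iteration 0, started from the stepsize gamma0, the algorithm may
   reach the computation of xbar^0 with stepsize gamma; xinit is the point
   denoted by xbar^{-1}. *)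
Inductive stepsize_reached gamma0 x0 xinit : R -> Prop :=
| stepsize_reached_start : stepsize_reached gamma0 x0 xinit gamma0
| stepsize_reached_halve_gamma gamma xbar :
    stepsize_reached gamma0 x0 xinit gamma ->
    suboptimal_min gamma x0 xinit xbar ->
    stepsize_rejected gamma x0 xbar ->
    stepsize_reached gamma0 x0 xinit (gamma / 2).

(* During an iteration k > 0 whose predecessor ended with gammap, xp, xbarp,
   the algorithm may reach the computation of x^k with current values gamma,
   d, tau.  The attempts discarded on the way, including their directions and
   their points xbar, are existentially quantified. *)
Inductive trial_reached gammap xp xbarp : R -> 'rV[R]_n -> R -> Prop :=
| trial_reached_start d :
    enorm d <= D * enorm (xbarp - xp) ->
    trial_reached gammap xp xbarp gammap d 1
| trial_reached_halve_gamma gamma d tau xbar d' :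
    trial_reached gammap xp xbarp gamma d tau ->
    suboptimal_min gamma (trial_point xp xbarp d tau) xbarp xbar ->
    stepsize_rejected gamma (trial_point xp xbarp d tau) xbar ->
    enorm d' <= D * enorm (xbarp - xp) ->
    trial_reached gammap xp xbarp (gamma / 2) d' 1
| trial_reached_halve_tau gamma d tau xbar :
    trial_reached gammap xp xbarp gamma d tau ->
    suboptimal_min gamma (trial_point xp xbarp d tau) xbarp xbar ->
    ~~ stepsize_rejected gamma (trial_point xp xbarp d tau) xbar ->
    linesearch_rejected gammap xp xbarp gamma (trial_point xp xbarp d tau) xbar ->
    trial_reached gammap xp xbarp gamma d (tau / 2).

(* The sequences consist of the final accepted values of each iteration;
   the entries d 0 and tau 0 are not used by the algorithm. *)
Record panocp_iterates (gamma0 : R) (x0 xinit : 'rV[R]_n)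
    (x xbar d : nat -> 'rV[R]_n) (gamma tau : nat -> R) : Prop := {
  iter0_x : x 0%N = x0;
  iter0_gamma : stepsize_reached gamma0 x0 xinit (gamma 0%N);
  iter0_xbar : suboptimal_min (gamma 0%N) (x 0%N) xinit (xbar 0%N);
  iter0_stepsize : ~~ stepsize_rejected (gamma 0%N) (x 0%N) (xbar 0%N);
  iterS_trial k :
    trial_reached (gamma k) (x k) (xbar k) (gamma k.+1) (d k.+1) (tau k.+1);
  iterS_x k : x k.+1 = trial_point (x k) (xbar k) (d k.+1) (tau k.+1);
  iterS_xbar k : suboptimal_min (gamma k.+1) (x k.+1) (xbar k) (xbar k.+1);
  iterS_stepsize k : ~~ stepsize_rejected (gamma k.+1) (x k.+1) (xbar k.+1);
  iterS_linesearch k :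
    ~~ linesearch_rejected (gamma k) (x k) (xbar k)
                        (gamma k.+1) (x k.+1) (xbar k.+1)
}.

End inexact_panocp.

(* Main.v *)
Require Import Defs.
From HB Require Import structures.
From mathcomp Require Import all_boot all_order all_algebra.
From mathcomp Require Import all_classical all_reals all_analysis.
From mathcomp Require Import ring lra.

Set Implicit Arguments.
Unset Strict Implicit.
Unset Printing Implicit Defensive.

Import Order.TTheory GRing.Theory Num.Theory.
Import numFieldNormedType.Exports.

Local Open Scope classical_set_scope.
Local Open Scope ring_scope.

(** The merit values Phi_k decrease.  An accepted pair (x^k, xbar^k) satisfies
    the descent inequality with constant alpha, so Phi_k dominates
    phi(xbar^k) plus (1 - alpha) / (2 gamma_k) times the squared residual
    |xbar^k - x^k|^2 ([cost_le_model]); it is bounded below by inf phi.  The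
    linesearch test makes Phi_k drop at every iteration by a fixed multiple of
    |xbar^k - x^k|^2 / gamma_k ([merit_descent]).  Telescoping gives (i) and
    (ii).  As the stepsizes never increase, the residuals tend to 0; each step
    |x^{k+1} - x^k| is at most (1 + D) times a residual ([trial_point_dist]),
    whence (iii), the set of limit points being connected by Ostrowski's
    argument on sequences with vanishing steps ([connected_cluster]).

    The stepsizes are the delicate point.  A stepsize c is rejected only when
    the descent inequality fails between a trial point and its suboptimal
    minimizer.  If f has a quadratic upper bound with constant C at all such
    pairs, a rejected c is at least alpha / (2 C) ([stepsize_rejected_ge]), so
    only finitely many halvings can occur ([gamma_eventually_constant]).  With a
    globally Lipschitz gradient the bound holds everywhere.  When the iterates
    are bounded, so are the trial points; prox-boundedness and
    gamma_0 < gamma_g confine their suboptimal minimizers to a bounded set too,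
    uniformly in the stepsize ([suboptimal_min_bounded]); and on a compact set a
    locally Lipschitz gradient yields one constant C
    ([quadratic_bound_compact]).  The rest of (vi) holds because phi(xbar^k) is
    at most Phi_0 and the residuals are bounded.

    Let r_k = |xbar^k - x^k|. For (iv): if the gamma_k were summable, so would
    be the residuals, by r_k <= gamma_k + r_k^2 / gamma_k, and hence the steps;
    the iterates would be bounded, and the stepsizes eventually constant and
    positive, which is absurd. For (v): if r_k / gamma_k stayed above e > 0 then
    e^2 gamma_k would be dominated by the summable r_k^2 / gamma_k,
    contradicting (iv).

    Only the order of magnitude of the constants matters, so estimates are
    carried out in the sup norm and transferred to the Euclidean norm. *)

(** * Euclidean norm and sup norm *)

Lemma near_norm_lt {R : realType} {V : normedModType R} (z : V) (r : R) :
  0 < r -> \forall u \near z, `|z - u| < r.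
Proof. by move=> r0; apply/nbhs_normP; exists r. Qed.

Section euclidean_norm.
Context {R : realType} {n : nat}.
Implicit Types (u v w : 'rV[R]_n).

Lemma norm_coord_le u i : `|u 0 i| <= `|u|.
Proof.
have -> : `|u| = \big[Num.max/0%R]_ij `|u ij.1 ij.2| by rewrite -mx_normrE.
exact: (le_bigmax _ (fun ij : 'I_1 * 'I_n => `|u ij.1 ij.2|) (0, i)).
Qed.

Lemma dotvBl u v w : dotv (u - v) w = dotv u w - dotv v w.
Proof.
by rewrite /dotv -sumrB; apply: eq_bigr => i _; rewrite !mxE mulrBl.
Qed.

Lemma dotvBr u v w : dotv w (u - v) = dotv w u - dotv w v.
Proof.
by rewrite /dotv -sumrB; apply: eq_bigr => i _; rewrite !mxE mulrBr.
Qed.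

Lemma dotvNl u v : dotv (- u) v = - dotv u v.
Proof. by rewrite /dotv -sumrN; apply: eq_bigr => i _; rewrite mxE mulNr. Qed.

Lemma dotvC u v : dotv u v = dotv v u.
Proof. by apply: eq_bigr => i _; rewrite mulrC. Qed.

Lemma norm_dotv_le u v : `|dotv u v| <= n%:R * `|u| * `|v|.
Proof.
apply: le_trans (ler_norm_sum _ _ _) _.
have -> : n%:R * `|u| * `|v| = \sum_(i < n) (`|u| * `|v|).
  by rewrite sumr_const card_ord -mulrA mulr_natl.
by apply: ler_sum => i _; rewrite normrM ler_pM ?norm_coord_le.
Qed.

Lemma dotv_ge0 u : 0 <= dotv u u.
Proof. by apply: sumr_ge0 => i _; rewrite -expr2 sqr_ge0. Qed.

Lemma enorm_ge0 u : 0 <= enorm u.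
Proof. exact: sqrtr_ge0. Qed.

Lemma sqr_enorm u : enorm u ^+ 2 = dotv u u.
Proof. by rewrite sqr_sqrtr ?dotv_ge0. Qed.

Lemma enormB u v : enorm (u - v) = enorm (v - u).
Proof.
rewrite /enorm -(opprB v u) dotvNl; congr Num.sqrt.
by rewrite dotvC dotvNl opprK.
Qed.

Lemma norm_le_enorm u : `|u| <= enorm u.
Proof.
have -> : `|u| = \big[Num.max/0%R]_ij `|u ij.1 ij.2| by rewrite -mx_normrE.
apply/bigmax_leP; split=> [|[i j] _ /=]; first exact: enorm_ge0.
rewrite -sqrtr_sqr ler_sqrt ?dotv_ge0// ord1 /dotv (bigD1 j)//= -expr2.
by rewrite lerDl sumr_ge0// => k _; rewrite -expr2 sqr_ge0.
Qed.

Lemma enorm_le_norm u : enorm u <= n%:R * `|u|.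
Proof.
rewrite -(@ler_pXn2r _ 2)// ?nnegrE ?enorm_ge0 ?mulr_ge0//.
rewrite sqr_enorm exprMn; apply: le_trans (ler_norm _) _.
apply: le_trans (norm_dotv_le _ _) _.
rewrite -mulrA -expr2 ler_wpM2r ?sqr_ge0//.
by rewrite -natrX ler_nat; case: (n) => // m; rewrite -mulnn leq_pmulr.
Qed.

(** The two norms are comparable, so null sequences may be studied in either. *)
Lemma cvg_enorm0 (u : nat -> 'rV[R]_n) (e : nat -> R) (c : R) :
  (forall k, `|u k| <= c * e k) -> e @ \oo --> 0 ->
  (fun k => enorm (u k)) @ \oo --> 0.
Proof.
move=> ue e0.
apply: (@squeeze_cvgr _ _ _ _ (cst 0) (fun k => (n%:R * c) * e k)).
- apply: nearW => k /=; rewrite enorm_ge0/= (le_trans (enorm_le_norm _))//.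
  by rewrite -mulrA ler_wpM2l.
- exact: cvg_cst.
- by rewrite -[X in _ --> X](mulr0 (n%:R * c)); apply: cvgMr.
Qed.

End euclidean_norm.

(** * Quadratic upper bounds on a smooth function *)

Section quadratic_upper_bound.
Context {R : realType} {n : nat} (f : 'rV[R]_n -> R).
Hypothesis f_diff : forall z, differentiable f z.
Implicit Types (u v x y z : 'rV[R]_n).

Lemma derive_gradient x v : 'D_v f x = dotv (gradient f x) v.
Proof.
rewrite deriveE// {1}(row_sum_delta v) linear_sum/= /dotv.
apply: eq_bigr => i _.
by rewrite linearZ/= -deriveE// mxE mulrC.
Qed.

Lemma gradient_mean_value x y : exists2 t, t \in `[0, 1] &
  f y - f x = dotv (gradient f (x + t *: (y - x))) (y - x).
Proof.
set v := y - x; pose h (t : R) : R := f (x + t *: v).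
pose dh (t : R) : R := dotv (gradient f (x + t *: v)) v.
have hD t : is_derive t (1 : R) h (dh t).
  have E : (fun s : R => s^-1 *: ((h \o shift t) (s *: (1 : R)) - h t)) =
           (fun s : R => s^-1 *: ((f \o shift (x + t *: v)) (s *: v)
                                  - f (x + t *: v))).
    apply/funext => s /=; rewrite /h/=; congr (_ *: (f _ - _)).
    by rewrite (_ : s *: (1 : R) = s) ?scalerDl 1?addrCA//; exact: mulr1.
  have fD : derivable f (x + t *: v) v by apply: diff_derivable.
  split; first by rewrite /derivable E.
  by rewrite /derive E -[LHS]/('D_v f (x + t *: v)) derive_gradient.
have hc : {within `[0, 1], continuous h}.
  apply: continuous_subspaceT => t.
  by apply/differentiable_continuous/derivable1_diffP; case: (hD t).
have [t t01 ht] := MVT_segment ler01 (fun t _ => hD t) hc.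
exists t => //; move: ht; rewrite subr0 mulr1 /h /dh scale1r scale0r addr0.
by rewrite /v subrKC.
Qed.

(** The descent inequality at the pair (u, v) with a constant C in place of half
    a Lipschitz constant. *)
Definition quadratic_bound (C : R) u v :=
  f v <= f u + dotv (gradient f u) (v - u) + C * enorm (v - u) ^+ 2.

Lemma quadratic_bound_le (C C' : R) u v :
  C <= C' -> quadratic_bound C u v -> quadratic_bound C' u v.
Proof.
move=> CC' /le_trans; apply; rewrite lerD2l ler_wpM2r//.
exact: exprn_ge0 (enorm_ge0 _).
Qed.

(** The first-order error is the increment of the gradient between u and an
    intermediate point, paired with v - u; the mean value theorem thus suffices,
    at the price of the factor n that bounds the pairing in the sup norm. *)
Lemma quadratic_bound_lipschitz (L : R) u v :
  (forall t, t \in `[0, 1] ->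
     `|gradient f (u + t *: (v - u)) - gradient f u|
       <= L * `|u + t *: (v - u) - u|) ->
  0 <= L -> quadratic_bound (n%:R * L) u v.
Proof.
move=> lip L0; have [t t01 e] := gradient_mean_value u v.
rewrite /quadratic_bound -addrA -lerBlDl e -lerBlDl -dotvBl.
apply: le_trans (ler_norm _) _; apply: le_trans (norm_dotv_le _ _) _.
rewrite -!mulrA ler_wpM2l// expr2 mulrA.
apply: ler_pM => //; last exact: norm_le_enorm.
apply: le_trans (lip _ t01) _; rewrite ler_wpM2l//.
rewrite addrAC subrr add0r normrZ.
move: t01; rewrite in_itv/= => /andP[t0 t1].
rewrite ger0_norm//; apply: le_trans (norm_le_enorm _).
by rewrite ler_piMl.
Qed.

Lemma locally_lipschitz_ball (F : 'rV[R]_n -> 'rV[R]_n) z :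
  locally_lipschitz F -> exists L e, [/\ 0 <= L, 0 < e &
    forall u v, `|z - u| < e -> `|z - v| < e -> `|F u - F v| <= L * `|u - v|].
Proof.
move=> /(_ z)[U /nbhs_normP[e/= e0 zU] [M [_ UM]]].
exists (`|M| + 1), e; split => [|//|u v uU vU]; first by rewrite addr_ge0.
apply: (UM _ _ (u, v)); first by rewrite (le_lt_trans (ler_norm _))// ltrDl.
by split; apply: zU.
Qed.

Lemma locally_lipschitz_continuous (F : 'rV[R]_n -> 'rV[R]_n) :
  locally_lipschitz F -> continuous F.
Proof.
move=> Flip z; have [L [e [L0 e0 lip]]] := locally_lipschitz_ball z Flip.
apply: (iffRL (@cvgrPdist_lt _ _ _ (nbhs z) _ F (F z))) => r r0.
have L10 : 0 < L + 1 by rewrite ltr_wpDl.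
have : \forall u \near z, `|z - u| < Num.min e (r / (L + 1)).
  by apply: near_norm_lt; rewrite lt_min e0 divr_gt0.
apply: filterS => u; rewrite lt_min => /andP[zue zur].
apply: le_lt_trans (lip _ _ _ zue) _; first by rewrite subrr normr0.
move: zur; rewrite ltr_pdivlMr//; apply: le_lt_trans.
by rewrite mulrC ler_wpM2l// lerDl.
Qed.

Lemma compact_cube (r : R) : compact [set z : 'rV[R]_n | `|z| <= r].
Proof.
apply: bounded_closed_compact.
  exists r; split => [|M rM z /= zr]; first exact: num_real.
  by rewrite (le_trans zr)// ltW.
have -> : [set z : 'rV[R]_n | `|z| <= r] = closed_ball_ Num.norm 0 r.
  by apply/funext => z; rewrite /closed_ball_/= sub0r normrN.
exact: closed_closed_ball_.
Qed.

Lemma continuous_bounded_cube (W : normedModType R) (F : 'rV[R]_n -> W)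
    (r : R) : continuous F ->
  exists2 M, 0 <= M & forall z, `|z| <= r -> `|F z| <= M.
Proof.
move=> Fc; have /compact_bounded[M [_ MP]] : compact (F @` [set z | `|z| <= r]).
  apply: continuous_compact; last exact: compact_cube.
  exact: continuous_subspaceT.
exists (`|M| + 1) => [|z zr]; first by rewrite addr_ge0.
apply: MP; last by exists z.
by rewrite (le_lt_trans (ler_norm _))// ltrDl.
Qed.

(** By compactness of K x K it is enough to find a constant near each pair
    (x, y).  Near the diagonal, both points lie in one ball on which the
    gradient is Lipschitz.  Off the diagonal, every continuous quantity is
    bounded and |v - u| is bounded away from 0, so that a large C works. *)
Lemma quadratic_bound_compact (K : set 'rV[R]_n) :
  locally_lipschitz (gradient f) -> compact K ->
  exists2 C, 0 < C & forall u v, K u -> K v -> quadratic_bound C u v.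
Proof.
move=> grad_lip Kc.
have nearN (z : 'rV[R]_n) r : 0 < r -> \forall u \near z, `|z - u| < r.
  exact: near_norm_lt.
have /compact_near_coveringP cov := compact_setX Kc Kc.
have := cov R (pinfty_nbhs R) (fun C uv => quadratic_bound C uv.1 uv.2) _ _.
case.
- move=> [x y] _; have [<-{y}|xy] := eqVneq x y.
  + have [L [e [L0 e0 lip]]] := locally_lipschitz_ball x grad_lip.
    exists ([set u | `|x - u| < e] `*` [set u | `|x - u| < e],
            [set C | n%:R * L <= C]) => /=.
      split; last by apply: nbhs_pinfty_ge; exact: num_real.
      by exists ([set u | `|x - u| < e], [set u | `|x - u| < e]) => //=;
        split; exact: nearN.
    move=> [[u v] C]/= [[xu xv] LC]; apply: quadratic_bound_le LC _.
    apply: quadratic_bound_lipschitz => // t; rewrite in_itv/= => /andP[t0 t1].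
    apply: lip => //.
    (* the ball around x is convex, so it contains the segment *)
    have -> : x - (u + t *: (v - u)) = (1 - t) *: (x - u) + t *: (x - v).
      by apply/rowP => i; rewrite !mxE; ring.
    apply: le_lt_trans (ler_normD _ _) _; rewrite !normrZ.
    rewrite !ger0_norm ?subr_ge0//.
    have [->|tN0] := eqVneq t 0; first by rewrite subr0 mul0r addr0 mul1r.
    have tp : 0 < t by rewrite lt_neqAle eq_sym tN0.
    have : t * `|x - v| < t * e by rewrite ltr_pM2l.
    have : (1 - t) * `|x - u| <= (1 - t) * e.
      by rewrite ler_wpM2l ?subr_ge0// ltW.
    by lra.
  + (* off the diagonal the error is bounded while v - u stays away from 0 *)
    have [L [e [L0 e0 lip]]] := locally_lipschitz_ball x grad_lip.
    have d0 : 0 < `|x - y| by rewrite normr_gt0 subr_eq0.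
    set d := `|x - y| in d0.
    have d30 : 0 < d / 3 by rewrite divr_gt0.
    have fN z : \forall u \near z, `|f z - f u| < 1.
      have /cvgrPdist_lt := differentiable_continuous (f_diff z); exact.
    pose U := [set u | [/\ `|x - u| < e, `|x - u| < d / 3 & `|f x - f u| < 1]].
    pose V := [set v | `|y - v| < d / 3 /\ `|f y - f v| < 1].
    have xU : nbhs x U.
      by near=> u; split; near: u; [exact: nearN|exact: nearN|exact: fN].
    have yV : nbhs y V by near=> v; split; near: v; [exact: nearN|exact: fN].
    pose A := `|f y - f x| + 2 + n%:R * (`|gradient f x| + L * e) * (2 * d).
    have A0 : 0 <= A.
      by rewrite !addr_ge0// !mulr_ge0 ?addr_ge0 ?mulr_ge0 ?(ltW e0) ?(ltW d0).
    exists (U `*` V, [set C | A / (d / 3) ^+ 2 <= C]) => /=.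
      split; last by apply: nbhs_pinfty_ge; exact: num_real.
      by exists (U, V).
    move=> [[u v] C]/= [[[xu1 xu2 fu] [yv fv]] leC]; rewrite /quadratic_bound.
    have uvd : d / 3 <= `|v - u|.
      have : `|x - y| <= `|x - u| + `|v - u| + `|y - v|.
        rewrite (_ : x - y = (x - u) - (v - u) - (y - v)).
          by rewrite (le_trans (ler_normB _ _))// lerD2r ler_normB.
        by apply/rowP => i; rewrite !mxE; ring.
      by rewrite -/d; lra.
    have duv : `|v - u| <= 2 * d.
      have : `|v - u| <= `|x - u| + `|x - y| + `|y - v|.
        rewrite (_ : v - u = (x - u) - (x - y) - (y - v)).
          by rewrite (le_trans (ler_normB _ _))// lerD2r ler_normB.
        by apply/rowP => i; rewrite !mxE; ring.
      by rewrite -/d; lra.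
    have gu : `|gradient f u| <= `|gradient f x| + L * e.
      have := lip u x xu1; rewrite subrr normr0 => /(_ e0) lipu.
      rewrite -lerBlDl (le_trans (lerB_dist _ _))// (le_trans lipu)//.
      by rewrite ler_wpM2l// distrC ltW.
    have : A <= C * enorm (v - u) ^+ 2.
      have C0 : 0 <= C by rewrite (le_trans _ leC)// divr_ge0// exprn_ge0// ltW.
      move: leC; rewrite ler_pdivrMr ?exprn_gt0// => /le_trans; apply.
      rewrite ler_wpM2l// ler_pXn2r ?nnegrE ?(ltW d30) ?enorm_ge0//.
      exact: le_trans uvd (norm_le_enorm _).
    have : `|dotv (gradient f u) (v - u)|
        <= n%:R * (`|gradient f x| + L * e) * (2 * d).
      by rewrite (le_trans (norm_dotv_le _ _))// ler_pM// ?ler_wpM2l// mulr_ge0.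
    move: fu fv (ler_norm (f y - f x)) (ler_norm (f x - f y)).
    rewrite /A (distrC (f x) (f y)) !ltr_norml !ler_norml.
    by move=> /andP[? ?] /andP[? ?] ? ? /andP[? ?] ?; lra.
- move=> M [Mr MP]; exists (`|M| + 1); first by rewrite ltr_wpDl.
  move=> u v Ku Kv; apply: (MP _ _ (u, v)) => //.
  by rewrite (le_lt_trans (ler_norm _))// ltrDl.
Unshelve. all: by end_near. Qed.

End quadratic_upper_bound.

(** * Series, halving sequences and limit points *)

Section sequences.
Context {R : realType}.

Lemma nneseries_lty (a : nat -> R) (M : R) : (forall k, 0 <= a k) ->
  (forall N, \sum_(0 <= k < N) a k <= M) ->
  (\sum_(0 <= k <oo) (a k)%:E < +oo)%E.
Proof.
move=> a0 aM; apply: (@le_lt_trans _ _ M%:E); last exact: ltry.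
apply: lime_le; first by apply: is_cvg_nneseries => k _ _; rewrite lee_fin.
by apply: nearW => N; rewrite sumEFin lee_fin.
Qed.

Lemma nneseries_lty_bounded (a : nat -> R) : (forall k, 0 <= a k) ->
  (\sum_(0 <= k <oo) (a k)%:E < +oo)%E ->
  exists M, forall N, \sum_(0 <= k < N) a k <= M.
Proof.
move=> a0; set s := (\sum_(0 <= k <oo) (a k)%:E)%E => soo.
have s0 : (0 <= s)%E by apply: nneseries_ge0 => k _ _; rewrite lee_fin.
exists (fine s) => N; rewrite -lee_fin fineK ?ge0_fin_numE// -sumEFin.
by apply: nneseries_lim_ge => k _ _; rewrite lee_fin.
Qed.

Lemma nneseries_ge_pinfty (a : nat -> R) (c : R) (N : nat) :
  (forall k, 0 <= a k) -> 0 < c -> (forall k, (N <= k)%N -> c <= a k) ->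
  (\sum_(0 <= k <oo) (a k)%:E = +oo)%E.
Proof.
move=> a0 c0 ac; apply/eqP; rewrite -leye_eq leNgt; apply/negP.
move=> /(nneseries_lty_bounded a0)[M aM].
have lb m : c * m%:R <= \sum_(0 <= k < N + m) a k.
  elim: m => [|m IH]; first by rewrite mulr0 sumr_ge0.
  by rewrite addnS big_nat_recr//= mulrSr mulrDr mulr1 lerD// ac// leq_addr.
have := lb (Num.bound `|M / c|); apply/negP; rewrite -ltNge.
apply: le_lt_trans (aM _) _; rewrite mulrC -ltr_pdivrMr//.
by apply: le_lt_trans (ler_norm _) _; exact: archi_boundP (normr_ge0 _).
Qed.

Lemma limn_einf_eq0 (u : nat -> R) : (forall k, 0 <= u k) ->
  (forall e N, 0 < e -> exists2 k, (N <= k)%N & u k < e) ->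
  limn_einf (fun k => (u k)%:E) = 0%E.
Proof.
move=> u0 uI; rewrite limn_einf_lim.
suff -> : einfs (fun k => (u k)%:E) = cst 0%E by exact: lim_cst.
apply/funext => N; apply/eqP; rewrite eq_le; apply/andP; split.
  apply/lee_addgt0Pr => e /(uI _ N)[k Nk uke]; rewrite add0e.
  apply: (@le_trans _ _ (u k)%:E); last by rewrite lee_fin ltW.
  by apply: ereal_inf_lbound; exists k.
by apply: le_ereal_inf_tmp => _ [k _ <-]; rewrite lee_fin.
Qed.

(** Past an index where g is less than twice its infimum, which is positive, no
    halving can take place. *)
Lemma halving_eventually_constant (g : nat -> R) (c : R) : 0 < c ->
  (forall k, c <= g k) -> (forall k, g k.+1 = g k \/ g k.+1 <= g k / 2) ->
  exists kappa, forall k, (kappa <= k)%N -> g k = g kappa.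
Proof.
move=> c0 cg gS; have gI : has_inf (range g).
  by split; [exists (g 0%N); exists 0%N | exists c => _ [k _ <-]].
set s := inf (range g).
have sg k : s <= g k by apply: ge_inf; [case: gI | exists k].
have s0 : 0 < s.
  apply: lt_le_trans c0 _; apply: lb_le_inf; first by case: gI.
  by move=> _ [k _ <-].
have [_ [kappa _ <-] gk] : exists2 y, range g y & y < s + s.
  exact: inf_adherent.
exists kappa => k; elim: k => [|k IH]; first by rewrite leqn0 => /eqP ->.
rewrite leq_eqVlt => /predU1P[<-//|]; rewrite ltnS => /IH gkE.
have [->//|] := gS k; move: gk; rewrite -gkE => gk gSk.
by have := sg k.+1; lra.
Qed.

Context {V : normedModType R}.
Implicit Types (x y : nat -> V).

Lemma cluster_seqP x p : cluster (x @ \oo) p <->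
  forall e N, 0 < e -> exists2 k, (N <= k)%N & `|x k - p| < e.
Proof.
split=> [xp e N e0|xp A B [N _ NA] /nbhs_normP[e/= e0 eB]].
  have [|/=|_ [[k /= Nk <-] /= ke]] :=
      xp [set x k | k in [set k | (N <= k)%N]] [set z | `|p - z| < e].
  - by exists N => // k /= Nk; exists k.
  - by apply/nbhs_normP; exists e.
  - by exists k; rewrite // distrC.
have [k Nk ke] := xp e N e0; exists (x k); split; first exact: NA.
by apply: eB; rewrite /= distrC.
Qed.

Lemma cluster_cvg_dist x y : (fun k => `|x k - y k|) @ \oo --> 0 ->
  cluster (x @ \oo) `<=` cluster (y @ \oo).
Proof.
move=> xy p /cluster_seqP xp; apply/cluster_seqP => e N e0.
have e20 : 0 < e / 2 by rewrite divr_gt0.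
move/cvgrPdist_lt : xy => /(_ _ e20)[M _ MP].
have [k] := xp _ (maxn N M) e20; rewrite geq_max => /andP[Nk Mk] ke.
exists k => //; move: (MP k Mk) => /=; rewrite sub0r normrN normr_id => xyk.
rewrite (splitr e) (_ : y k - p = (x k - p) - (x k - y k)).
  by rewrite (le_lt_trans (ler_normB _ _))// ltrD.
by rewrite opprB [RHS]addrC subrKA.
Qed.

Lemma closed_cluster (T : topologicalType) (F : set_system T) :
  closed (cluster F).
Proof.
by rewrite clusterE; apply: closed_bigI => A _; exact: closed_closure.
Qed.

(** If it were not connected, the set of limit points would split into two
    compact sets at a distance d > 0 from each other.  The tail of the sequence
    stays within d / 3 of their union, and its steps are eventually shorter than
    d / 3, hence too short to pass from one set to the other; yet both have to
    be approached infinitely often. *)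
Lemma connected_cluster (K : set V) x : compact K -> (forall k, K (x k)) ->
  (fun k => `|x k.+1 - x k|) @ \oo --> 0 -> connected (cluster (x @ \oo)).
Proof.
move=> Kc Kx dx; apply: contrapT => /connectedPn[E [E0 CE [sep1 sep2]]].
set C := cluster (x @ \oo) in CE.
have CK : C `<=` K.
  move=> p Cp; apply: compact_closed Kc _ _ => //.
  move=> B pB; have [|_ [[k _ <-] Bk]] := Cp (range x) B _ pB.
    by exists 0%N => // k _; exists k.
  by exists (x k).
have clE b : closure (E b) `<=` E false `|` E true.
  have Ccl : closed C by exact: closed_cluster.
  rewrite -CE ((closure_id C).1 Ccl).
  by apply: closureS; rewrite CE; case: (b); [exact: subsetUr|exact: subsetUl].
have Ecl b : closed (E b).
  move=> p clEp; have := clE b p clEp; move: clEp; case: b => clEp [] // Ep.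
    by have : (E false `&` closure (E true)) p by []; rewrite sep2.
  by have : (closure (E false) `&` E true) p by []; rewrite sep1.
have Ec : compact (E false).
  apply: (subclosed_compact (Ecl false) Kc).
  by apply: subset_trans CK; rewrite CE; exact: subsetUl.
have covE := (compact_near_coveringP _).1 Ec.
have covK := (compact_near_coveringP _).1 Kc.
have [d d0 dE] : exists2 d : R, 0 < d &
    forall a b, E false a -> E true b -> d <= `|a - b|.
  have := covE R 0^'+ (fun d a => forall b, E true b -> d <= `|a - b|) _.
  case=> [a Ea|M M0 MP]; last first.
    have MP2 : M / 2 < M by rewrite ltr_pdivrMr// ltr_pMr// ltr1n.
    exists (M / 2) => [|a b Ea Eb]; first by rewrite divr_gt0.
    apply: MP => //=; last by rewrite divr_gt0.
    by rewrite sub0r normrN gtr0_norm ?divr_gt0.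
  have /nbhs_normP[e /= e0 eE] : nbhs a (~` E true).
    apply: open_nbhs_nbhs; split; first exact/closed_openC.
    by move=> Ea'; have : (E false `&` closure (E true)) a;
      [split => //; exact: subset_closure|rewrite sep2].
  have e20 : 0 < e / 2 by rewrite divr_gt0.
  exists ([set a' | `|a - a'| < e / 2], [set r | r < e / 2]) => /=.
    by split; [exact: near_norm_lt|exact: nbhs_right_lt].
  move=> [a' r] /= [aa' re] b Eb; rewrite leNgt; apply/negP => a'b.
  apply: (eE b) => //=; rewrite -(subrKA a') (le_lt_trans (ler_normD _ _))//.
  by rewrite (splitr e) ltrD// (lt_trans a'b).
have d30 : 0 < d / 3 by rewrite divr_gt0.
pose near_part b k := exists2 c, E b c & `|x k - c| < d / 3.
have [N tail] : exists N, forall k, (N <= k)%N ->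
    near_part false k \/ near_part true k.
  have [z Kz|N _ NP] := covK nat \oo
    (fun k z => x k = z -> exists2 c, C c & `|x k - c| < d / 3) _; last first.
    exists N => k Nk; have [c] := NP k Nk (x k) (Kx k) erefl.
    by rewrite CE => -[Ec' xkc|Ec' xkc]; [left|right]; exists c.
  have [Cz|Cz] := pselect (C z).
    exists ([set u | `|z - u| < d / 3], setT) => /=.
      by split; [exact: near_norm_lt|exact: filterT].
    by move=> [u k] /= [zu _] ->; exists z; rewrite // distrC.
  have [e [M [e0 eM]]] : exists e M, 0 < e /\
      forall k, (M <= k)%N -> e <= `|x k - z|.
    apply: contrapT => h; apply: Cz; apply/cluster_seqP => e N e0.
    apply: contrapT => h'; apply: h; exists e, N; split => // k Nk.
    by rewrite leNgt; apply/negP => xke; apply: h'; exists k.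
  exists ([set u | `|z - u| < e], [set k | (M <= k)%N]) => /=.
    by split; [exact: near_norm_lt|exists M].
  move=> [u k] /= [zu Mk] xku; have := eM k Mk.
  by rewrite leNgt xku distrC zu.
move/cvgrPdist_lt : dx => /(_ _ d30)[N' _ step].
have approach b M : exists2 k, (M <= k)%N & near_part b k.
  have [c Ec'] := E0 b.
  have /cluster_seqP/(_ _ M d30)[k Mk xkc] : C c.
    by rewrite CE; case: (b) Ec'; [right|left].
  by exists k => //; exists c.
have not_both k : near_part false k -> ~ near_part true k.
  move=> [a Ea xa] [b Eb xb]; have := dE _ _ Ea Eb.
  have := ler_normD (a - x k) (x k - b).
  by rewrite subrKA (distrC a (x k)); lra.
have [k] := approach false (maxn N N'); rewrite geq_max => /andP[Nk N'k] ek.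
have stay j : near_part false (k + j)%N.
  elim: j => [|j IH]; first by rewrite addn0.
  have [|//|[b Eb xb]] := tail (k + j.+1)%N.
    by rewrite (leq_trans Nk)// leq_addr.
  case: IH => a Ea xa.
  have := step (k + j)%N (leq_trans N'k (leq_addr _ _)).
  rewrite /= sub0r normrN normr_id -addnS => xx.
  have := dE _ _ Ea Eb; have := ler_normD (a - x (k + j)%N) (x (k + j)%N - b).
  have := ler_normD (x (k + j)%N - x (k + j.+1)%N) (x (k + j.+1)%N - b).
  rewrite !subrKA (distrC a (x _)) (distrC (x (k + j)%N) (x (k + j.+1)%N)).
  by lra.
have [j kj] := approach true k.
by apply: not_both; rewrite -(subnKC kj).
Qed.

End sequences.

(** * The model and its suboptimal minimizers *)

Section merit_function.
Context {R : realType} {n : nat}.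
Variables (f : 'rV[R]_n -> R) (g : 'rV[R]_n -> \bar R) (alpha : R).
Implicit Types (x z u v w p : 'rV[R]_n) (c : R).

(** The model without its possibly infinite term g z, so that the estimates can
    be carried out in R. *)
Definition smooth_model c x z : R :=
  f x + dotv (gradient f x) (z - x) + (2 * c)^-1 * enorm (z - x) ^+ 2.

Lemma modelE c x z : model f g c x z = ((smooth_model c x z)%:E + g z)%E.
Proof.
rewrite /model /lagrangian dotvNl (enormB x) -(opprB z x).
have -> : dotv (gradient f x) (- (z - x)) = - dotv (gradient f x) (z - x).
  by rewrite dotvC dotvNl dotvC.
rewrite opprK /smooth_model invfM (mulrC 2^-1).
by case: (g z) => [r| |]//; rewrite -!EFinD; congr _%:E; ring.
Qed.

(** An accepted step satisfies the descent inequality with the constant alpha,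
    so that a fraction 1 - alpha of the proximal term is left over. *)
Lemma cost_le_model c x z : ~~ stepsize_rejected f alpha c x z ->
  (cost f g z + ((1 - alpha) / (2 * c) * enorm (z - x) ^+ 2)%:E
    <= model f g c x z)%E.
Proof.
rewrite /stepsize_rejected -leNgt modelE /cost => acc.
rewrite addeAC -EFinD leeD2r// lee_fin /smooth_model.
have -> : (1 - alpha) / (2 * c) = (2 * c)^-1 - alpha / (2 * c).
  by rewrite mulrBl mul1r.
by rewrite mulrBl; lra.
Qed.

(** Rejection and the quadratic bound sandwich f v, which leaves
    alpha / (2 c) < C. *)
Lemma stepsize_rejected_ge c (C : R) x v : 0 < c -> 0 < C ->
  quadratic_bound f C x v -> stepsize_rejected f alpha c x v ->
  alpha / (2 * C) <= c.
Proof.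
rewrite /stepsize_rejected /quadratic_bound => c0 C0 qb /lt_le_trans/(_ qb).
rewrite ltrD2l => h.
have e0 : 0 < enorm (v - x) ^+ 2.
  rewrite lt_neqAle exprn_ge0 ?enorm_ge0// andbT eq_sym.
  by apply/negP => /eqP e0; move: h; rewrite e0 !mulr0 ltxx.
move: h; rewrite ltr_pM2r// ltr_pdivrMr ?mulr_gt0// => h.
by rewrite ler_pdivrMr ?mulr_gt0//; lra.
Qed.

(** Prox-boundedness gives g v >= m - |v|^2 / (2 gammap).  Multiplying the
    suboptimality inequality by 2 c leaves the quadratic term
    (1 - c / gammap) |v|^2 on the left, whose coefficient is at least
    th = 1 - gamma0 / gammap > 0, against a right-hand side A |v| + B.  After
    this multiplication everything is bounded uniformly in c <= gamma0, however
    small c is. *)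
Lemma suboptimal_min_bounded (gamma0 gammap r P G : R) : proper_fun g ->
  0 < gamma0 -> gamma0 < gammap -> prox_parameters g gammap ->
  0 <= r -> 0 <= P ->
  exists rho, forall c x w v, 0 < c -> c <= gamma0 ->
    `|x| <= r -> `|w| <= r -> `|gradient f x| <= P -> (g w <= G%:E)%E ->
    suboptimal_min f g c x w v -> `|v| <= rho.
Proof.
move=> [g_gtNy _] g0 g0p [gp0 [m mP]] r0 P0.
set N : R := n%:R; have N0 : 0 <= N by rewrite ler0n.
pose A : R := 2 * (N * r) + 2 * gamma0 * (N * P).
pose B : R := 2 * gamma0 * (`|G| + `|m|) + 2 * gamma0 * (N * P * r)
  + (N * (2 * r)) ^+ 2.
pose th : R := 1 - gamma0 / gammap.
have th0 : 0 < th by rewrite subr_gt0 ltr_pdivrMr// mul1r.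
have A0 : 0 <= A by rewrite addr_ge0 ?mulr_ge0// ltW.
have B0 : 0 <= B.
  by rewrite !addr_ge0 ?exprn_ge0 ?mulr_ge0 ?addr_ge0// ltW.
exists (1 + (A + B) / th) => c x w v c0 cg xr wr pP gwG.
rewrite /suboptimal_min !modelE.
have [gw gwE] : exists gw, g w = gw%:E.
  by move: (g_gtNy w) gwG; case: (g w) => [gw| |]// _ _; exists gw.
have := mP v; move: (g_gtNy v); rewrite gwE.
case: (g v) => [gv _| |]//.
rewrite -!EFinD !lee_fin => gv_m sub.
move: gwG; rewrite gwE lee_fin => gwG.
set a := `|v|; set S := dotv v v.
have a0 : 0 <= a by exact: normr_ge0.
have aS : a ^+ 2 <= S.
  rewrite /S -sqr_enorm ler_pXn2r ?nnegrE ?enorm_ge0//.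
  exact: norm_le_enorm.
have pv : - (N * P * a) <= dotv (gradient f x) v.
  have : `|dotv (gradient f x) v| <= N * P * a.
    by rewrite (le_trans (norm_dotv_le _ _))// ler_wpM2r// ler_wpM2l.
  by rewrite ler_norml => /andP[].
have pw : dotv (gradient f x) w <= N * P * r.
  apply: le_trans (ler_norm _) _; rewrite (le_trans (norm_dotv_le _ _))//.
  by rewrite ler_pM// ?mulr_ge0// ler_wpM2l.
have vx : S - 2 * (N * r * a) <= enorm (v - x) ^+ 2.
  rewrite sqr_enorm dotvBr !dotvBl (dotvC x v).
  have : `|dotv v x| <= N * r * a.
    by rewrite (le_trans (norm_dotv_le _ _))// mulrAC ler_wpM2r// ler_wpM2l.
  rewrite ler_norml => /andP[_]; have := dotv_ge0 x; rewrite -/S; lra.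
have wx : enorm (w - x) ^+ 2 <= (N * (2 * r)) ^+ 2.
  rewrite ler_pXn2r ?nnegrE ?enorm_ge0 ?mulr_ge0//.
  rewrite (le_trans (enorm_le_norm _))// ler_wpM2l//.
  by rewrite (le_trans (ler_normB _ _))// mulrDl mul1r lerD.
(* compare the two models, multiplied by 2 c *)
have key : th * a ^+ 2 <= A * a + B.
  move: sub; rewrite /smooth_model !dotvBr => sub.
  set E1 := enorm (v - x) ^+ 2 in vx sub.
  set E2 := enorm (w - x) ^+ 2 in wx sub.
  move: gv_m; rewrite sqr_enorm -/S => gv_m.
  have h : E1 - E2 <= 2 * c * (N * P * a + N * P * r + `|G| + `|m|)
      + c / gammap * S.
    have s2 : (2 * c)^-1 * (E1 - E2) <=
        N * P * a + N * P * r + `|G| + `|m| + (2 * gammap)^-1 * S.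
      by have := ler_norm G; have := ler_norm (- m); rewrite normrN; lra.
    have c20 : 0 < 2 * c by rewrite mulr_gt0.
    have : 2 * c * ((2 * c)^-1 * (E1 - E2)) <=
        2 * c * (N * P * a + N * P * r + `|G| + `|m| + (2 * gammap)^-1 * S).
      by rewrite ler_pM2l.
    rewrite mulVKf ?gt_eqF// => /le_trans; apply.
    rewrite [leLHS]mulrDr lerD2l.
    suff -> : 2 * c * ((2 * gammap)^-1 * S) = c / gammap * S by [].
    by field; rewrite gt_eqF.
  have S0 : 0 <= S by exact: dotv_ge0.
  have h1 : c / gammap * S <= gamma0 / gammap * S.
    by rewrite ler_wpM2r// ler_wpM2r// invr_ge0 ltW.
  have h2 : 2 * c * (N * P * a + N * P * r + `|G| + `|m|) <=
      2 * gamma0 * (N * P * a + N * P * r + `|G| + `|m|).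
    by rewrite ler_wpM2r ?ler_wpM2l// !addr_ge0 ?mulr_ge0.
  have h3 : th * a ^+ 2 <= th * S by rewrite ler_wpM2l// (ltW th0).
  have h4 : th * S = S - gamma0 / gammap * S by rewrite /th mulrBl mul1r.
  by rewrite /A /B; lra.
rewrite leNgt; apply/negP => ra.
(* with |v| > 1 the bound th |v|^2 <= A |v| + B forces th |v| <= A + B *)
have a1 : 1 < a.
  by apply: le_lt_trans ra; rewrite lerDl divr_ge0 ?(ltW th0)// addr_ge0.
have : th * a ^+ 2 <= (A + B) * a.
  by apply: le_trans key _; rewrite [leRHS]mulrDl lerD2l ler_peMr// ltW.
rewrite expr2 mulrA ler_pM2r; last by rewrite (lt_trans _ a1).
by move: ra; rewrite -ltrBrDl ltr_pdivrMr//; rewrite -/a; lra.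
Qed.

End merit_function.

(** * Points and stepsizes tried during an iteration *)

Section linesearch.
Context {R : realType} {n : nat}.
Variables (f : 'rV[R]_n -> R) (g : 'rV[R]_n -> \bar R) (D alpha beta : R).
Variables (gammap : R) (xp xbarp : 'rV[R]_n).
Hypothesis gammap_gt0 : 0 < gammap.

Local Notation reached := (trial_reached f g D alpha beta gammap xp xbarp).

Lemma trial_reached_bounds c d t : reached c d t ->
  [/\ 0 < c, c <= gammap, 0 <= t <= 1 & enorm d <= D * enorm (xbarp - xp)].
Proof.
elim=> [d' dD|c' d' t' xb d'' _ [c0 cg _ _] _ _ dD
       |c' d' t' xb _ [c0 cg /andP[t0 t1] dD] _ _ _].
- by split; rewrite ?ler01 ?lexx.
- by split; rewrite ?ler01 ?lexx ?divr_gt0//; lra.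
- by split => //; lra.
Qed.

Lemma trial_reached_halving c d t : reached c d t ->
  c = gammap \/ c <= gammap / 2.
Proof.
elim=> [d' _|c' d' t' xb d'' r _ _ _ _|//]; first by left.
by right; have [_ cg _ _] := trial_reached_bounds r; rewrite ler_pM2r.
Qed.

(** A trial point lies between xbarp and xp + d, both of which are at a distance
    from xp controlled by the previous residual. *)
Lemma trial_point_dist c d t : 0 <= D -> reached c d t ->
  `|trial_point xp xbarp d t - xp| <= (1 + D) * enorm (xbarp - xp).
Proof.
move=> D0 /trial_reached_bounds[_ _ /andP[t0 t1] dD].
have -> : trial_point xp xbarp d t - xp = (1 - t) *: (xbarp - xp) + t *: d.
  by rewrite /trial_point; apply/rowP => i; rewrite !mxE; ring.
apply: le_trans (ler_normD _ _) _; rewrite !normrZ !ger0_norm ?subr_ge0//.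
rewrite [leRHS]mulrDl mul1r lerD//.
  by rewrite (le_trans _ (norm_le_enorm _))// ler_piMl// gerBl.
by rewrite (le_trans _ dD)// (le_trans _ (norm_le_enorm _))// ler_piMl.
Qed.

(** The last halving of the stepsize, if any, was caused by a rejection. *)
Lemma trial_reached_ge (lb : R) c d t :
  (forall c d t xbar, reached c d t ->
     suboptimal_min f g c (trial_point xp xbarp d t) xbarp xbar ->
     stepsize_rejected f alpha c (trial_point xp xbarp d t) xbar -> lb <= c) ->
  reached c d t -> c = gammap \/ lb / 2 <= c.
Proof.
move=> lbP; elim=> [d' _|c' d' t' xb d'' r _ sub rej _|//]; first by left.
by right; rewrite ler_pM2r//; exact: lbP r sub rej.
Qed.

End linesearch.

(** * Convergence of the iterates *)

Section iterates.
Context {R : realType} {n : nat}.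
Variables (f : 'rV[R]_n -> R) (g : 'rV[R]_n -> \bar R).
Variables (gamma0 D alpha beta : R) (x0 xinit : 'rV[R]_n).
Variables (x xbar d : nat -> 'rV[R]_n) (gamma tau : nat -> R).
Hypothesis g_proper : proper_fun g.
Hypothesis phi_inf : (-oo < ereal_inf (range (cost f g)))%E.
Hypothesis gamma0_gt0 : 0 < gamma0.
Hypothesis D_ge0 : 0 <= D.
Hypothesis alpha_01 : 0 < alpha < 1.
Hypothesis beta_01 : 0 < beta < 1.
Hypothesis run :
  panocp_iterates f g D alpha beta gamma0 x0 xinit x xbar d gamma tau.
Hypothesis xbar0_dom : (g (xbar 0%N) < +oo)%E.

Local Notation res k := (enorm (xbar k - x k)).

Lemma gamma_bounds k : 0 < gamma k <= gamma0.
Proof.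
elim: k => [|k /andP[gk gk0]].
  elim: (iter0_gamma run) => [|c xb _ /andP[c0 cg] _ _].
    by rewrite lexx gamma0_gt0.
  by rewrite divr_gt0//=; lra.
have [c0 cg _ _] := trial_reached_bounds gk (iterS_trial run k).
by rewrite c0 (le_trans cg).
Qed.

Let gamma_gt0 k : 0 < gamma k. Proof. by case/andP: (gamma_bounds k). Qed.
Let gamma_le k : gamma k <= gamma0. Proof. by case/andP: (gamma_bounds k). Qed.

Lemma step_le k : `|x k.+1 - x k| <= (1 + D) * res k.
Proof.
rewrite (iterS_x run).
exact: (trial_point_dist (gamma_gt0 k) D_ge0 (iterS_trial run k)).
Qed.

Let stepsize_accepted k :
  ~~ stepsize_rejected f alpha (gamma k) (x k) (xbar k).
Proof.
by case: k => [|k]; [exact: (iter0_stepsize run)|exact: (iterS_stepsize run)].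
Qed.

Lemma g_xbar_fin k : g (xbar k) \is a fin_num.
Proof.
have [gNy _] := g_proper.
rewrite fin_numE gNy/= -ltey; elim: k => [//|k gk].
have := iterS_linesearch run k; rewrite /linesearch_rejected -leNgt !modelE.
move: gk (gNy (xbar k)); case: (g (xbar k)) => [r| |]// _ _.
by case: (g (xbar k.+1)) => [s| |]//; rewrite ltry.
Qed.

(** The value Phi_k as a real number; the linesearch propagates finiteness from
    the initial value. *)
Definition merit k : R :=
  smooth_model f (gamma k) (x k) (xbar k) + fine (g (xbar k)).

Lemma model_merit k : model f g (gamma k) (x k) (xbar k) = (merit k)%:E.
Proof. by rewrite modelE /merit [RHS]EFinD fineK ?g_xbar_fin. Qed.

Definition scaled_residual k : R := (gamma k)^-1 * res k ^+ 2.

Let rate := beta * (1 - alpha) / 2.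

Let rate_gt0 : 0 < rate.
Proof.
case/andP: alpha_01 beta_01 => ? ? /andP[? _].
by rewrite divr_gt0 ?mulr_gt0 ?subr_gt0.
Qed.

Lemma scaled_residual_ge0 k : 0 <= scaled_residual k.
Proof.
rewrite mulr_ge0 ?invr_ge0 ?(ltW (gamma_gt0 k))//.
by rewrite exprn_ge0// enorm_ge0.
Qed.

Lemma merit_descent k : merit k.+1 <= merit k - rate * scaled_residual k.
Proof.
have := iterS_linesearch run k.
rewrite /linesearch_rejected -leNgt !model_merit.
rewrite -EFinB lee_fin => /le_trans; apply; rewrite lerD2l lerN2.
suff -> : beta * ((1 - alpha) / (2 * gamma k)) * res k ^+ 2 =
    rate * scaled_residual k by [].
by rewrite /rate /scaled_residual; field; rewrite gt_eqF.
Qed.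

Lemma cost_le_merit k : (cost f g (xbar k) <= (merit k)%:E)%E.
Proof.
rewrite -model_merit; apply: le_trans (cost_le_model g (stepsize_accepted k)).
rewrite leeDl// lee_fin mulr_ge0 ?exprn_ge0 ?enorm_ge0// divr_ge0//.
  by case/andP: alpha_01 => _ /ltW; rewrite subr_ge0.
by rewrite mulr_ge0// ltW.
Qed.

Lemma inf_cost_le_merit k : (ereal_inf (range (cost f g)) <= (merit k)%:E)%E.
Proof.
by apply: le_trans (cost_le_merit k); apply: ereal_inf_lbound; exists (xbar k).
Qed.

Let phi_min := fine (ereal_inf (range (cost f g))).

Lemma inf_cost_fin : ereal_inf (range (cost f g)) = phi_min%:E.
Proof.
rewrite fineK// fin_numE gt_eqF//= -ltey.
by apply: le_lt_trans (inf_cost_le_merit 0%N) _; exact: ltry.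
Qed.

Let phi_min_le k : phi_min <= merit k.
Proof. by rewrite -lee_fin -inf_cost_fin inf_cost_le_merit. Qed.

Lemma merit_nonincreasing : nonincreasing_seq merit.
Proof.
apply/nonincreasing_seqP => k; apply: le_trans (merit_descent k) _.
by rewrite gerBl mulr_ge0 ?(ltW rate_gt0) ?scaled_residual_ge0.
Qed.

Lemma sum_scaled_residual_le N :
  \sum_(0 <= k < N) scaled_residual k <= (merit 0%N - phi_min) / rate.
Proof.
rewrite ler_pdivlMr// mulrC; apply: (@le_trans _ _ (merit 0%N - merit N)).
  elim: N => [|N IH]; first by rewrite big_geq// mulr0 subrr.
  by rewrite big_nat_recr//= mulrDr; have := merit_descent N; lra.
by rewrite lerD2l lerN2.
Qed.

Lemma merit_cvg : merit @ \oo --> inf (range merit).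
Proof.
apply: nonincreasing_cvgn merit_nonincreasing _.
by exists phi_min => _ [k _ <-].
Qed.

(** The squared residual is at most gamma0 / rate times the drop of the merit
    value. *)
Lemma residual_cvg0 : (fun k => res k) @ \oo --> 0.
Proof.
have drop0 : (fun k => gamma0 / rate * (merit k - merit k.+1)) @ \oo --> 0.
  rewrite -[X in _ --> X](mulr0 (gamma0 / rate)); apply: cvgMr.
  rewrite -[X in _ --> X](subrr (inf (range merit))); apply: cvgB => //.
    exact: merit_cvg.
  by rewrite (cvg_shiftS merit); exact: merit_cvg.
have sq0 : (fun k => res k ^+ 2) @ \oo --> 0.
  apply: (squeeze_cvgr _ (cvg_cst 0) drop0); apply: nearW => k.
  rewrite exprn_ge0 ?enorm_ge0//=.
  have -> : res k ^+ 2 = gamma k * scaled_residual k.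
    by rewrite /scaled_residual mulVKf// gt_eqF.
  rewrite -mulrA ler_pM ?scaled_residual_ge0 ?(ltW (gamma_gt0 k))//.
  by rewrite mulrC ler_pdivlMr// mulrC; have := merit_descent k; lra.
have -> : (fun k => res k) = Num.sqrt \o (fun k => res k ^+ 2).
  by apply/funext => k /=; rewrite sqrtr_sqr ger0_norm ?enorm_ge0.
rewrite -[X in _ --> X]sqrtr0; apply: continuous_cvg sq0.
exact: sqrt_continuous.
Qed.

Lemma residual_bounded : exists2 E, 0 <= E & forall k, res k <= E.
Proof.
have : cvgn (fun k => res k) by apply/cvg_ex; exists 0; exact: residual_cvg0.
move=> /cvg_seq_bounded[M [_ MP]].
exists (`|M| + 1) => [|k]; first by rewrite addr_ge0.
apply: le_trans (ler_norm _) _; apply: MP => //.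
by rewrite (le_lt_trans (ler_norm _))// ltrDl.
Qed.

Lemma step_cvg0 : (fun k => `|x k.+1 - x k|) @ \oo --> 0.
Proof.
have h : (fun k => (1 + D) * res k) @ \oo --> 0.
  by rewrite -[X in _ --> X](mulr0 (1 + D)); apply: cvgMr; exact: residual_cvg0.
apply: (squeeze_cvgr _ (cvg_cst 0) h); apply: nearW => k /=.
by rewrite normr_ge0 step_le.
Qed.

Lemma xbar_step_le k :
  `|xbar k.+1 - xbar k| <= res k.+1 + (2 + D) * res k.
Proof.
have -> : xbar k.+1 - xbar k =
    (xbar k.+1 - x k.+1) + (x k.+1 - x k) - (xbar k - x k).
  by apply/rowP => i; rewrite !mxE; ring.
have := ler_normB (xbar k.+1 - x k.+1 + (x k.+1 - x k)) (xbar k - x k).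
have := ler_normD (xbar k.+1 - x k.+1) (x k.+1 - x k).
have := norm_le_enorm (xbar k.+1 - x k.+1).
have := norm_le_enorm (xbar k - x k).
by have := step_le k; lra.
Qed.

Lemma cluster_x_xbar : cluster (x @ \oo) = cluster (xbar @ \oo).
Proof.
have dist0 : (fun k => `|xbar k - x k|) @ \oo --> 0.
  apply: (squeeze_cvgr _ (cvg_cst 0) residual_cvg0); apply: nearW => k /=.
  by rewrite normr_ge0 norm_le_enorm.
apply/seteqP; split; apply: cluster_cvg_dist => //.
by under eq_fun do rewrite distrC.
Qed.

Lemma bounded_rangeP (y : nat -> 'rV[R]_n) :
  bounded_set (range y) <-> exists M, forall k, `|y k| <= M.
Proof.
split=> [[M [_ MP]]|[M MP]].
  exists (`|M| + 1) => k; apply: MP; last by exists k.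
  by rewrite (le_lt_trans (ler_norm _))// ltrDl.
exists M; split => [|r Mr _ [k _ <-]]; first exact: num_real.
by rewrite /= (le_trans (MP k))// ltW.
Qed.

Lemma bounded_xbar_x : bounded_set (range xbar) <-> bounded_set (range x).
Proof.
have [E E0 rE] := residual_bounded.
rewrite !bounded_rangeP; split=> -[M MP]; exists (M + E) => k.
  rewrite -(subKr (xbar k) (x k)) (le_trans (ler_normB _ _))// lerD//.
  exact: le_trans (norm_le_enorm _) (rE k).
rewrite -(subrKC (x k) (xbar k)) (le_trans (ler_normD _ _))// lerD//.
exact: le_trans (norm_le_enorm _) (rE k).
Qed.

Lemma level_bounded_xbar :
  level_bounded (cost f g) -> bounded_set (range xbar).
Proof.
move=> /(_ (merit 0%N))[M [_ MP]]; apply/bounded_rangeP.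
exists (`|M| + 1) => k; apply: MP.
  by rewrite (le_lt_trans (ler_norm _))// ltrDl.
apply: le_trans (cost_le_merit k) _; rewrite lee_fin.
exact: merit_nonincreasing.
Qed.

Local Notation reached k :=
  (trial_reached f g D alpha beta (gamma k) (x k) (xbar k)).
Local Notation trial k := (trial_point (x k) (xbar k)).

(** Every rejected stepsize is at least alpha / (2 C), so that a stepsize
    changed after iteration 0 is at least alpha / (4 C); and a sequence that
    changes only by halvings, while bounded away from 0, is eventually
    constant. *)
Lemma gamma_eventually_constant (C : R) : 0 < C ->
  (forall k c d t v, reached k c d t ->
     suboptimal_min f g c (trial k d t) (xbar k) v ->
     quadratic_bound f C (trial k d t) v) ->
  exists kappa, forall k, (kappa <= k)%N -> gamma k = gamma kappa.
Proof.
move=> C0 qb; set lb := alpha / (2 * C).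
have lb0 : 0 < lb by case/andP: alpha_01 => ? _; rewrite divr_gt0 ?mulr_gt0.
have gS k : gamma k.+1 = gamma k \/ lb / 2 <= gamma k.+1.
  apply: trial_reached_ge (iterS_trial run k) => c d' t v r sub.
  have [c0 _ _ _] := trial_reached_bounds (gamma_gt0 k) r.
  by apply: stepsize_rejected_ge => //; exact: qb r sub.
apply: (@halving_eventually_constant _ _ (Num.min (gamma 0%N) (lb / 2))).
- by rewrite lt_min gamma_gt0 divr_gt0.
- elim=> [|k IH]; first by rewrite ge_min lexx.
  by have [->//|h] := gS k; rewrite ge_min h orbT.
- by move=> k; exact: trial_reached_halving (iterS_trial run k).
Qed.

Hypothesis f_diff : forall z, differentiable f z.

Lemma lipschitz_gamma_eventually_constant : lipschitz (gradient f) ->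
  exists kappa, forall k, (kappa <= k)%N -> gamma k = gamma kappa.
Proof.
move=> [M [_ MP]]; pose L := `|M| + 1.
have L0 : 0 <= L by rewrite addr_ge0.
apply: (@gamma_eventually_constant (n%:R * L + 1)).
  by rewrite ltr_wpDl// mulr_ge0.
move=> k c d' t v _ _.
apply: (@quadratic_bound_le _ _ _ (n%:R * L)); first by rewrite lerDl.
apply: quadratic_bound_lipschitz => // s _.
apply: (MP L _ (_, _)) => //.
by rewrite (le_lt_trans (ler_norm _))// ltrDl.
Qed.

Hypothesis f_grad : locally_lipschitz (gradient f).
Variable gamma_g : \bar R.
Hypothesis g_prox : prox_bounded g gamma_g.
Hypothesis gamma0_lt : (gamma0%:E < gamma_g)%E.

(** All the points tried lie in one cube: the trial points because steps are
    controlled by residuals, their suboptimal minimizers by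
    [suboptimal_min_bounded].  The latter needs an upper bound on g at the
    previous points xbar, which follows from the decrease of the merit
    values and the boundedness of f on the cube. *)
Lemma bounded_gamma_eventually_constant : bounded_set (range x) ->
  exists kappa, forall k, (kappa <= k)%N -> gamma k = gamma kappa.
Proof.
move=> bx; have /bounded_rangeP[r0 xr] := bx.
have /bounded_xbar_x/bounded_rangeP[r1 xbarr] := bx.
have [E E0 rE] := residual_bounded.
pose r := `|r0| + `|r1| + (1 + D) * E.
have DE : 0 <= (1 + D) * E by rewrite mulr_ge0 ?addr_ge0.
have r_ge0 : 0 <= r by rewrite !addr_ge0.
have trial_r k c d' t : reached k c d' t -> `|trial k d' t| <= r.
  move=> rch; have := trial_point_dist (gamma_gt0 k) D_ge0 rch.
  have : (1 + D) * res k <= (1 + D) * E by rewrite ler_wpM2l ?addr_ge0.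
  have := ler_normD (trial k d' t - x k) (x k); rewrite subrK.
  have := xr k; have := ler_norm r0; have := normr_ge0 r1; rewrite /r; lra.
have xbar_r k : `|xbar k| <= r.
  have := xbarr k; have := ler_norm r1; have := normr_ge0 r0.
  by rewrite /r; lra.
have [P P0 gradP] :=
  continuous_bounded_cube r (locally_lipschitz_continuous f_grad).
have [F F0 fF] : exists2 F, 0 <= F & forall z, `|z| <= r -> `|f z| <= F.
  by apply: continuous_bounded_cube => z; exact: differentiable_continuous.
have g_le k : (g (xbar k) <= (merit 0%N + F)%:E)%E.
  have := cost_le_merit k; have := merit_nonincreasing (leq0n k).
  rewrite /cost -(fineK (g_xbar_fin k)) -EFinD !lee_fin => ? ?.
  by have := fF _ (xbar_r k); rewrite ler_norml => /andP[? _]; lra.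
have [_ g_sup] := g_prox.
have [_ [gammap pp <-]] :
    exists2 y, (EFin @` prox_parameters g) y & (gamma0%:E < y)%E.
  by apply: ereal_sup_gt; rewrite -g_sup.
rewrite lte_fin => g0p.
have [rho rhoP] := suboptimal_min_bounded f (merit 0%N + F)
  g_proper gamma0_gt0 g0p pp r_ge0 P0.
have [C C0 qb] := quadratic_bound_compact f_diff f_grad
  (@compact_cube R n (Num.max r rho)).
apply: (gamma_eventually_constant C0) => k c d' t v rch sub.
have [c0 cg _ _] := trial_reached_bounds (gamma_gt0 k) rch.
have tr := trial_r _ _ _ _ rch.
apply: qb => /=; rewrite le_max; first by rewrite tr.
by rewrite (rhoP c (trial k d' t) (xbar k)) ?orbT// ?gradP ?(le_trans cg).
Qed.

(** If the sum were finite, the residuals would be summable, being at most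
    gamma k plus the scaled residual; hence so would be the steps, the iterates
    would be bounded, and the stepsizes eventually equal to a positive
    constant. *)
Lemma sum_gamma_pinfty : (\sum_(0 <= k <oo) (gamma k)%:E = +oo)%E.
Proof.
have gamma_ge0 k := ltW (gamma_gt0 k).
apply/eqP; rewrite -leye_eq leNgt; apply/negP => fin.
have [M gM] := nneseries_lty_bounded gamma_ge0 fin.
have res_le k : res k <= gamma k + scaled_residual k.
  have -> : res k = gamma k * ((gamma k)^-1 * res k) by rewrite mulVKf// gt_eqF.
  have -> : scaled_residual k = gamma k * ((gamma k)^-1 * res k) ^+ 2.
    by rewrite /scaled_residual; field; rewrite gt_eqF.
  set s := (gamma k)^-1 * res k.
  rewrite -[X in X + _]mulr1 -mulrDr ler_wpM2l//.
  have := sqr_ge0 (s - 1); rewrite sqrrB1 expr2.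
  by have := sqr_ge0 s; rewrite expr2; lra.
have bx : bounded_set (range x).
  pose T := M + (merit 0%N - phi_min) / rate.
  apply/bounded_rangeP; exists (`|x 0%N| + (1 + D) * T) => k.
  have : `|x k| <= `|x 0%N| +
      (1 + D) *
        (\sum_(0 <= j < k) gamma j + \sum_(0 <= j < k) scaled_residual j).
    elim: k => [|k IH]; first by rewrite !big_geq// addr0 mulr0 addr0.
    rewrite !big_nat_recr//=; have := ler_normD (x k.+1 - x k) (x k).
    have : (1 + D) * res k <= (1 + D) * (gamma k + scaled_residual k).
      by rewrite ler_wpM2l ?addr_ge0.
    by rewrite subrK; have := step_le k; lra.
  move=> /le_trans; apply; rewrite lerD2l ler_wpM2l ?addr_ge0//.
  by rewrite lerD// sum_scaled_residual_le.
have [kappa gk] := bounded_gamma_eventually_constant bx.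
have := @nneseries_ge_pinfty _ gamma (gamma kappa) kappa gamma_ge0
  (gamma_gt0 _).
by move=> h; move: fin; rewrite h ?ltxx// => k /gk ->.
Qed.

(** A positive lower bound on the quotients would make gamma k a multiple of a
    summable term, as the scaled residual is gamma k times the square of the
    quotient. *)
Lemma liminf_residual :
  limn_einf (fun k => ((gamma k)^-1 * res k)%:E) = 0%E.
Proof.
apply: limn_einf_eq0 => [k|e N e0].
  by rewrite mulr_ge0 ?invr_ge0 ?enorm_ge0// ltW.
apply: contrapT => h.
have ge_e k : (N <= k)%N -> e <= (gamma k)^-1 * res k.
  by move=> Nk; rewrite leNgt; apply/negP => lt_e; apply: h; exists k.
have := sum_gamma_pinfty; apply/eqP; rewrite lt_eqF//.
pose T := \sum_(0 <= k < N) gamma k.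
apply: (@nneseries_lty _ _ (T + (e ^+ 2)^-1 * ((merit 0%N - phi_min) / rate))).
  by move=> k; exact: ltW.
move=> m.
apply: (@le_trans _ _
  (T + (e ^+ 2)^-1 * \sum_(0 <= k < m) scaled_residual k)).
  elim: m => [|m IH].
    by rewrite !big_geq// mulr0 addr0 sumr_ge0// => k _; exact: ltW.
  have [mN|Nm] := ltnP m N.
    rewrite -[leLHS]addr0 lerD//.
      rewrite /T (@big_cat_nat _ _ _ m.+1 0 N)//= lerDl sumr_ge0// => k _.
      exact: ltW.
    rewrite mulr_ge0 ?invr_ge0 ?sqr_ge0// sumr_ge0// => k _.
    exact: scaled_residual_ge0.
  rewrite !big_nat_recr//= mulrDr addrA lerD// mulrC ler_pdivlMr ?exprn_gt0//.
  have -> : scaled_residual m = gamma m * ((gamma m)^-1 * res m) ^+ 2.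
    by rewrite /scaled_residual; field; rewrite gt_eqF.
  rewrite ler_wpM2l ?(ltW (gamma_gt0 m))//.
  rewrite lerXn2r ?nnegrE ?(ltW e0)// ?ge_e//.
  by rewrite (le_trans (ltW e0))// ge_e.
by rewrite lerD2l ler_wpM2l ?invr_ge0 ?sqr_ge0// sum_scaled_residual_le.
Qed.

End iterates.

(** * The convergence theorem *)

Theorem theorem4p3 (R : realType) (n : nat)
    (f : 'rV[R]_n -> R) (g : 'rV[R]_n -> \bar R) (gamma_g : \bar R)
    (gamma0 D alpha beta : R) (x0 xinit : 'rV[R]_n)
    (x xbar d : nat -> 'rV[R]_n) (gamma tau : nat -> R)
    (f_diff : forall z, differentiable f z)
    (f_grad : locally_lipschitz (gradient f))
    (g_proper : proper_fun g)
    (g_lsc : lower_semicontinuous g)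
    (g_prox : prox_bounded g gamma_g)
    (phi_inf : (-oo < ereal_inf (range (cost f g)))%E)
    (gamma0_gt0 : 0 < gamma0) (gamma0_lt : (gamma0%:E < gamma_g)%E)
    (D_ge0 : 0 <= D)
    (alpha_01 : 0 < alpha < 1) (beta_01 : 0 < beta < 1)
    (run : panocp_iterates f g D alpha beta gamma0 x0 xinit x xbar d gamma tau)
    (x_neq_xbar : forall k, x k != xbar k)
    (xbar0_dom : (g (xbar 0%N) < +oo)%E) :
  let Phi k := model f g (gamma k) (x k) (xbar k) in
  let bounded_x := bounded_set (range x) in
  let bounded_xbar := bounded_set (range xbar) in
  let gamma_asymptotically_constant :=
    exists kappa, forall k, (kappa <= k)%N -> gamma k = gamma kappa in
  (* (i) *)
  (exists phi_star : R,
    [/\ Phi @ \oo --> phi_star%:E,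
        forall k, (phi_star%:E <= Phi k)%E
      & (ereal_inf (range (cost f g)) <= phi_star%:E)%E]) /\
  (* (ii) *)
  (\sum_(0 <= k <oo) ((gamma k)^-1 * enorm (xbar k - x k) ^+ 2)%:E < +oo)%E /\
  (* (iii) *)
  [/\ (fun k => enorm (x k - xbar k)) @ \oo --> (0 : R),
      (fun k => enorm (x k.+1 - x k)) @ \oo --> (0 : R)
    & (fun k => enorm (xbar k.+1 - xbar k)) @ \oo --> (0 : R)] /\
  [/\ closed (cluster (x @ \oo)),
      (bounded_x -> connected (cluster (x @ \oo)))
    & cluster (x @ \oo) = cluster (xbar @ \oo)] /\
  (* (iv) *)
  (\sum_(0 <= k <oo) (gamma k)%:E = +oo)%E /\
  (* (v) *)
  limn_einf (fun k => ((gamma k)^-1 * enorm (x k - xbar k))%:E) = 0%E /\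
  (* (vi) *)
  [/\ level_bounded (cost f g) -> bounded_xbar,
      bounded_xbar <-> bounded_x,
      bounded_x -> gamma_asymptotically_constant
    & lipschitz (gradient f) -> gamma_asymptotically_constant].
Proof.
move=> Phi bounded_x bounded_xbar gamma_asymptotically_constant.
have PhiE : Phi = EFin \o merit f g x xbar gamma.
  by apply/funext => k; exact: model_merit run xbar0_dom k.
have res0 := residual_cvg0 g_proper phi_inf gamma0_gt0 alpha_01 beta_01 run
  xbar0_dom.
have resS0 : (fun k => enorm (xbar k.+1 - x k.+1)) @ \oo --> (0 : R).
  by rewrite (cvg_shiftS (fun k => enorm (xbar k - x k))).
split; [|split; [|split; [|split; [|split; [|split]]]]].
- have m_cvg := merit_cvg g_proper phi_inf gamma0_gt0 alpha_01 beta_01 run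
    xbar0_dom.
  have m_ninc := merit_nonincreasing g_proper gamma0_gt0 alpha_01 beta_01 run
    xbar0_dom.
  exists (inf (range (merit f g x xbar gamma))); split.
  + by rewrite PhiE; apply: cvg_EFin => //; exact: nearW.
  + move=> k; rewrite PhiE /= lee_fin.
    have <- := cvg_lim (@Rhausdorff R) m_cvg.
    apply: nonincreasing_cvgn_ge => //; apply/cvg_ex; eexists; exact: m_cvg.
  + rewrite (inf_cost_fin g_proper phi_inf gamma0_gt0 alpha_01 run xbar0_dom).
    rewrite lee_fin; apply: lb_le_inf.
      by exists (merit f g x xbar gamma 0), 0%N.
    move=> _ [k _ <-]; rewrite -lee_fin.
    rewrite -(inf_cost_fin g_proper phi_inf gamma0_gt0 alpha_01 run xbar0_dom).
    exact: (inf_cost_le_merit g_proper gamma0_gt0 alpha_01 run xbar0_dom k).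
- apply: nneseries_lty => [k|N].
    exact: (scaled_residual_ge0 gamma0_gt0 run k).
  exact: (sum_scaled_residual_le g_proper phi_inf gamma0_gt0 alpha_01
    beta_01 run xbar0_dom N).
- split.
  + by under eq_fun do rewrite enormB.
  + apply: cvg_enorm0 res0 => k.
    exact: (step_le gamma0_gt0 D_ge0 run k).
  + apply: (@cvg_enorm0 _ _ _ (fun k => enorm (xbar k.+1 - x k.+1)
        + (2 + D) * enorm (xbar k - x k)) 1) => [k|].
      rewrite mul1r; exact: xbar_step_le gamma0_gt0 D_ge0 run k.
    rewrite -[X in _ --> X]addr0; apply: cvgD => //.
    by rewrite -[X in _ --> X](mulr0 (2 + D)); apply: cvgMr.
- split.
  + exact: closed_cluster.
  + move=> /bounded_rangeP[M xM].
    refine (connected_cluster (@compact_cube R n M) xM _).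
    exact: (step_cvg0 g_proper phi_inf gamma0_gt0 D_ge0 alpha_01 beta_01 run
      xbar0_dom).
  + exact: (cluster_x_xbar g_proper phi_inf gamma0_gt0 alpha_01 beta_01 run
      xbar0_dom).
- exact: (sum_gamma_pinfty g_proper phi_inf gamma0_gt0 D_ge0 alpha_01 beta_01
    run xbar0_dom f_diff f_grad g_prox gamma0_lt).
- under eq_fun do rewrite enormB.
  exact: (liminf_residual g_proper phi_inf gamma0_gt0 D_ge0 alpha_01 beta_01
    run xbar0_dom f_diff f_grad g_prox gamma0_lt).
- split.
  + exact: (level_bounded_xbar g_proper gamma0_gt0 alpha_01 beta_01 run
      xbar0_dom).
  + exact: (bounded_xbar_x g_proper phi_inf gamma0_gt0 alpha_01 beta_01 run
      xbar0_dom).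
  + exact: (bounded_gamma_eventually_constant g_proper phi_inf gamma0_gt0
      D_ge0 alpha_01 beta_01 run xbar0_dom f_diff f_grad g_prox gamma0_lt).
  + exact: (lipschitz_gamma_eventually_constant gamma0_gt0 alpha_01 run
      f_diff).
Qed.
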